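(* Let $n\ge 1$, $a>0$, $d>0$, $t_0=0$, $\mathbf y_0\in\mathbb R^n$ and $D=\{\mathbf y\in\mathbb R^n : \|\mathbf y-\mathbf y_0\|\le d\}$. Consider the initial value problem $$\mathbf y'(t)=\mathbf f(\mathbf y(t)),\qquad \mathbf y(t_0)=\mathbf y_0,$$ where $\mathbf y(t)$ is an $\mathbb R^n$ valued function of class $C^1$ on $|t-t_0|\le a$, and $\mathbf f$ is an $\mathbb R^n$ valued function with variable in $\mathbb R^n$ which is continuous on $D$, satisfies a Lipschitz condition with respect to $\mathbf y$ with constant $K>0$ (that is, $\|\mathbf f(\mathbf y)-\mathbf f(\mathbf w)\|\le K\|\mathbf y-\mathbf w\|$), and has the form $\mathbf f(\mathbf y)=A(\mathbf y)\cdot\mathbf y$, where $A(\mathbf y)$ is an $n\times n$ matrix whose entries are continuous on $D$. Let $0<t_N<a$ be fixed (the same for every $N$), and for each natural number $N$ let $\mathbf y_N(t)$, $t\in[t_0,t_N]$, be the segmentary approximate solution with $N$ subintervals and initial value $\mathbf y(t_0)=\mathbf y_0$ produced by the matrix method (defined in the context). Then, as $N\to\infty$ (equivalently, as $h=t_N/N\to 0$), the sequence $\{\mathbf y_N(t)\}$ converges uniformly on $[t_0,t_N]$ to a continuous function $\mathbf z:[t_0,t_N]\to\mathbb R^n$. Furthermore, $\mathbf z(t)$ is differentiable on $(t_0,t_N)$ and is the solution of the differential equation $\mathbf y'(t)=A(\mathbf y(t))\cdot\mathbf y(t)$ with initial value $\mathbf z(t_0)=\mathbf y(t_0)$.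
   Context: Here $\|\cdot\|$ denotes a norm on $\mathbb R^n$. The matrix method is as follows. The endpoint $t_N$ of the interval $[0,t_N]$ is a fixed number; the index $N$ only denotes the number of subintervals in the partition. Set $h=t_N/N$, $t_k=hk$ for $k=0,1,\dots,N$, and $I_k=[t_k,t_{k+1}]$ for $k=0,\dots,N-1$. The function $\mathbf y_N$ is defined successively on $I_0,I_1,\dots,I_{N-1}$, and $\mathbf y_{N,k}$ denotes its restriction to $I_k$. The starting values are $\mathbf y_{N,0}(t_0)=\mathbf y(t_0)=\mathbf y_0$ and $\mathbf y_{N,k}(t_k)=\mathbf y_{N,k-1}(t_k)$ for $k\ge 1$. Given $\mathbf y_{N,k}(t_k)$, one defines the constant vector $$\mathbf y^*_{N,k}=\exp\left\{A(\mathbf y_{N,k}(t_k))\,\frac h2\right\}\cdot\mathbf y_{N,k}(t_k),$$ and then $$\mathbf y_{N,k}(t)=\exp\left\{A(\mathbf y^*_{N,k})\,(t-t_k)\right\}\cdot\mathbf y_{N,k}(t_k),\qquad t\in I_k,$$ so that $\mathbf y_{N,k}$ is the solution on $I_k$ of the constant coefficient linear system $\mathbf y_{N,k}'(t)=A(\mathbf y^*_{N,k})\cdot\mathbf y_{N,k}(t)$ with the given value at $t_k$.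
   Formalization: It is assumed that the solution y(t) stays in D for |t| ≤ a and that, for all sufficiently large N, the vectors y_N(t_k) and y*_{N,k} (k < N), at which A is evaluated, lie in D; the limit z and the competing solutions in the uniqueness claim also take values in D. *)

(* Defs.v *)
(* MathComp-Analysis; R : realType, vectors of R^n are columns 'cV[R]_n. *)
From HB Require Import structures.
From mathcomp Require Import all_boot all_order all_algebra.
From mathcomp Require Import all_classical all_reals all_analysis.

Set Implicit Arguments.
Unset Strict Implicit.
Unset Printing Implicit Defensive.

Import Order.TTheory GRing.Theory Num.Theory.
Import numFieldNormedType.Exports.

Local Open Scope classical_set_scope.
Local Open Scope ring_scope.

(* An arbitrary norm on R^n, independent of the canonical (sup) norm `|x| that
   induces the topology of 'cV[R]_n. *)
Record is_norm (R : realType) (n : nat) (nrm : 'cV[R]_n -> R) : Prop := IsNorm {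
  is_norm_ge0 : forall x, 0 <= nrm x;
  is_norm_eq0 : forall x, nrm x = 0 -> x = 0;
  is_normZ : forall (c : R) x, nrm (c *: x) = `|c| * nrm x;
  is_normD : forall x y, nrm (x + y) <= nrm x + nrm y }.

Definition norm_ball (R : realType) (n : nat) (nrm : 'cV[R]_n -> R)
    (y0 : 'cV[R]_n) (d : R) : set 'cV[R]_n :=
  [set y | nrm (y - y0) <= d].

Definition lipschitz_wrt (R : realType) (n : nat) (nrm : 'cV[R]_n -> R)
    (K : R) (D : set 'cV[R]_n) (f : 'cV[R]_n -> 'cV[R]_n) : Prop :=
  forall y w, D y -> D w -> nrm (f y - f w) <= K * nrm (y - w).

Definition expmx (R : realType) (n : nat) (M : 'M[R]_n) : 'M[R]_n :=
  limn (series (fun k : nat => (k`!%:R)^-1 *: (M ^+ k))).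

(* Derivative of y at t relative to I: two-sided in the interior of an
   interval I, one-sided at its end points. *)
Definition is_derivative_within (R : realType) (n : nat) (I : set R)
    (y : R -> 'cV[R]_n) (t : R) (l : 'cV[R]_n) : Prop :=
  (s - t)^-1 *: (y s - y t) @[s --> within I t^'] --> l.

(* y is a C^1 solution on [-a, a] of y' = f(y), y(0) = y0.  As the right-hand
   side is only given on D, a solution takes its values in D. *)
Definition is_C1_solution (R : realType) (n : nat) (D : set 'cV[R]_n)
    (f : 'cV[R]_n -> 'cV[R]_n) (y0 : 'cV[R]_n) (a : R)
    (y : R -> 'cV[R]_n) : Prop :=
  [/\ y 0 = y0,
      forall t, t \in `[- a, a] -> D (y t) &
      exists2 dy : R -> 'cV[R]_n,
        {within `[- a, a], continuous dy} &
        forall t, t \in `[- a, a] ->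
          is_derivative_within `[- a, a] y t (dy t) /\ dy t = f (y t)].

(* u is the segmentary approximate solution on [0, T] with N subintervals.
   On I_k = [t_k, t_{k+1}], t_k = h k, h = T / N, u is given by the exponential
   formula with initial value u(t_k), which is also the value at t_k of the
   formula on I_{k-1}.  The matrix A is only given on D, so the construction
   makes sense only if the points u(t_k) and y*_k at which A is evaluated
   belong to D. *)
Definition segmentary_solution (R : realType) (n : nat) (D : set 'cV[R]_n)
    (A : 'cV[R]_n -> 'M[R]_n) (y0 : 'cV[R]_n) (T : R) (N : nat)
    (u : R -> 'cV[R]_n) : Prop :=
  let h := T / N%:R in
  let t_ := fun k : nat => h * k%:R in
  u 0 = y0 /\
  forall k : nat, (k < N)%N ->
    let ystar := expmx ((h / 2) *: A (u (t_ k))) *m u (t_ k) in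
    [/\ D (u (t_ k)), D ystar &
        forall t, t \in `[t_ k, t_ k.+1] ->
          u t = expmx ((t - t_ k) *: A ystar) *m u (t_ k)].

(* z is a solution on [0, T], with values in D, of y' = A(y) y, z(0) = y0. *)
Definition is_linear_form_solution (R : realType) (n : nat)
    (D : set 'cV[R]_n) (A : 'cV[R]_n -> 'M[R]_n) (y0 : 'cV[R]_n) (T : R)
    (z : R -> 'cV[R]_n) : Prop :=
  [/\ {within `[0, T], continuous z},
      z 0 = y0,
      forall t, t \in `[0, T] -> D (z t) &
      forall t, t \in `]0, T[ -> is_derive t (1 : R) z (A (z t) *m z t)].

(* Main.v *)
(** On the compact ball D the matrix A is bounded and f(y) = A(y) y is
    Lipschitz, also for the sup norm since all norms on R^n are equivalent.  On
    a cell of length h starting at u_k, with midpoint value p, the approximation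
    u has velocity A(p) u_k + O(h), and
      A(p) u_k - f(u_k) = A(p) (u_k - p) + (f(p) - f(u_k)) = O(h),
    so neither a Lipschitz nor a uniform continuity bound on A is needed.  The
    one-step defect against any solution w is therefore O(h^2), and the discrete
    Gronwall inequality gives |u - w| = O(1/N) on [0, T].  Taking w to be the
    given solution y yields the limit; since the approximations converge to
    every solution, the solution is unique. *)

Require Import Defs.
From HB Require Import structures.
From mathcomp Require Import all_boot all_order all_algebra.
From mathcomp Require Import all_classical all_reals all_analysis.
From mathcomp Require Import ring lra.

Set Implicit Arguments.
Unset Strict Implicit.
Unset Printing Implicit Defensive.

Import Order.TTheory GRing.Theory Num.Theory.
Import numFieldNormedType.Exports.

Local Open Scope classical_set_scope.
Local Open Scope ring_scope.

(* The library declares the norm and the completeness of matrices separately;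
   this joins them into a completeNormedModType. *)
HB.instance Definition _ (R : realType) m n := Complete.on 'M[R]_(m, n).

(** * Matrix sup norm, exponential estimates, discrete Gronwall *)

Lemma le_mx_norm (R : realType) m n (M : 'M[R]_(m, n)) i j : `|M i j| <= `|M|.
Proof.
rewrite [leRHS]/Num.Def.normr/= mx_normrE.
exact: (le_bigmax _ (fun ij => `|M ij.1 ij.2|) (i, j)).
Qed.

Lemma mx_norm_le (R : realType) m n (M : 'M[R]_(m, n)) c :
  0 <= c -> (forall i j, `|M i j| <= c) -> `|M| <= c.
Proof.
move=> c0 Mc; rewrite [leLHS]/Num.Def.normr/= mx_normrE.
by apply: bigmax_le => // -[i j] _; exact: Mc.
Qed.

(** The sup norm is not submultiplicative: each entry of the product is a sum of [n] terms, hence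
    the factor [n%:R] in all later bounds. *)
Lemma norm_mulmx (R : realType) m n p (M : 'M[R]_(m, n)) (N : 'M[R]_(n, p)) :
  `|M *m N| <= n%:R * `|M| * `|N|.
Proof.
apply: mx_norm_le => [|i j]; first by rewrite !mulr_ge0.
rewrite mxE; apply: (le_trans (ler_norm_sum _ _ _)).
apply: (@le_trans _ _ (\sum_(k < n) `|M| * `|N|)).
  by apply: ler_sum => k _; rewrite normrM ler_pM// le_mx_norm.
by rewrite sumr_const card_ord -[leLHS]mulr_natl mulrA.
Qed.

Lemma norm_mx_exp (R : realType) n (M : 'M[R]_n) k :
  `|M ^+ k| <= (n%:R * `|M|) ^+ k.
Proof.
elim: k => [|k IH].
  rewrite !expr0; apply: mx_norm_le => // i j.
  by rewrite mxE; case: (i == j); rewrite ?normr1 ?normr0.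
rewrite !exprS; apply: le_trans (norm_mulmx _ _) _.
by rewrite ler_wpM2l// mulr_ge0.
Qed.

Lemma norm_expmx_term (R : realType) n (M : 'M[R]_n) k :
  `|(k`!%:R)^-1 *: M ^+ k| <= exp_coeff (n%:R * `|M|) k.
Proof.
rewrite normrZ ger0_norm ?invr_ge0// /exp_coeff /= mulrC.
by rewrite ler_wpM2r ?invr_ge0// norm_mx_exp.
Qed.

(** Domination by the scalar exponential series at [n%:R * |M|]; it makes the [limn] in [expmx] a
    genuine limit rather than a default value. *)
Lemma is_cvg_expmx (R : realType) n (M : 'M[R]_n) :
  cvgn (series (fun k => (k`!%:R)^-1 *: M ^+ k)).
Proof.
apply: normed_cvg; apply: series_le_cvg (is_cvg_series_exp_coeff (n%:R * `|M|)).
- by move=> k /=.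
- by move=> k; apply: exp_coeff_ge0; rewrite mulr_ge0.
- by move=> k; exact: norm_expmx_term.
Qed.

Lemma series_exp_coeff_le (R : realType) (x : R) k :
  0 <= x -> series (exp_coeff x) k <= expR x.
Proof.
move=> x0; apply: nondecreasing_cvgn_le; last exact: is_cvg_series_exp_coeff.
by apply: nondecreasing_series => i _ _; exact: exp_coeff_ge0.
Qed.

(** Since [(m + i)! >= i!], the tail term of index [m + i] is at most [x ^+ m] times the term of
    index [i]. *)
Lemma sum_exp_coeff_tail (R : realType) (x : R) m k :
  0 <= x -> \sum_(m <= i < m + k) exp_coeff x i <= x ^+ m * expR x.
Proof.
move=> x0; apply: (@le_trans _ _ (x ^+ m * series (exp_coeff x) k)); last first.
  by rewrite ler_wpM2l ?exprn_ge0// series_exp_coeff_le.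
rewrite seriesEnat /= mulr_sumr -[X in index_iota X _]add0n big_addn addKn.
apply: ler_sum => i _; rewrite /exp_coeff /= exprD.
rewrite [x ^+ i * _]mulrC -[leLHS]mulrA.
rewrite ler_wpM2l ?exprn_ge0// ler_wpM2l ?exprn_ge0//.
rewrite lef_pV2 ?posrE ?ltr0n ?fact_gt0// ler_nat.
by apply: leq_fact; exact: leq_addr.
Qed.

Lemma expmx_taylor (R : realType) n (M : 'M[R]_n) m :
  `|expmx M - \sum_(0 <= k < m) (k`!%:R)^-1 *: M ^+ k| <=
  (n%:R * `|M|) ^+ m * expR (n%:R * `|M|).
Proof.
set x := n%:R * _; set S := \sum_(0 <= _ < m) _.
have x0 : 0 <= x by rewrite mulr_ge0.
have /cvg_norm cvgS : (fun N => series (fun k => (k`!%:R)^-1 *: M ^+ k) N - S)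
    @ \oo --> expmx M - S by apply: cvgB; [exact: is_cvg_expmx|exact: cvg_cst].
rewrite -(cvg_lim _ cvgS)//; apply: limr_le; first exact: cvgP cvgS.
near=> N; have mN : (m <= N)%N by near: N; exists m.
rewrite seriesEnat /= (big_cat_nat (leq0n m) mN)//= -/S [S + _]addrC addrK.
apply: le_trans (ler_norm_sum _ _ _) _; rewrite -(subnKC mN).
apply: le_trans (sum_exp_coeff_tail m (N - m) x0).
by apply: ler_sum => k _; exact: norm_expmx_term.
Unshelve. all: by end_near. Qed.

(** Taylor remainders of orders 1 and 2, with one constant for all [A] and [v] in bounded sets. The
    first controls the half step to the midpoint value, the second linearizes a whole step. *)
Lemma expmx_increment (R : realType) n (B V T : R) :
  exists2 C, 0 <= C & forall (A : 'M[R]_n) (v : 'cV[R]_n) (s : R),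
    `|A| <= B -> `|v| <= V -> 0 <= s -> s <= T ->
    `|expmx (s *: A) *m v - v| <= C * s /\
    `|expmx (s *: A) *m v - (v + s *: (A *m v))| <= C * s ^+ 2.
Proof.
(* Absolute values make these constants nonnegative whatever the signs of [B], [V] and [T]. *)
set b : R := n%:R * `|B|; set E : R := n%:R * expR (b * `|T|) * `|V|.
have b0 : 0 <= b by rewrite /b mulr_ge0.
have E0 : 0 <= E by rewrite /E !mulr_ge0 ?expR_ge0.
(* The order 1 remainder contributes [b * E], the order 2 remainder [b ^+ 2 * E]; the sum serves
   both. *)
exists ((b + b ^+ 2) * E); first by rewrite mulr_ge0// addr_ge0// exprn_ge0.
move=> A v s AB vV s0 sT.
have remainder m :
    `|(expmx (s *: A) - \sum_(0 <= k < m) (k`!%:R)^-1 *: (s *: A) ^+ k) *m v|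
    <= (b * s) ^+ m * E.
  apply: le_trans (norm_mulmx _ _) _.
  apply: (@le_trans _ _ (n%:R * ((b * s) ^+ m * expR (b * `|T|)) * `|V|)).
    have xb : n%:R * `|s *: A| <= b * s.
      rewrite normrZ (ger0_norm s0) mulrCA mulrC ler_wpM2r// ler_wpM2l//.
      exact: le_trans AB (ler_norm B).
    have xT : n%:R * `|s *: A| <= b * `|T|.
      by rewrite (le_trans xb)// ler_wpM2l// (le_trans sT)// ler_norm.
    apply: ler_pM => //.
    - apply: ler_wpM2l => //; apply: le_trans (expmx_taylor _ _) _.
      rewrite ler_pM ?exprn_ge0 ?mulr_ge0 ?expR_ge0 ?ler_expR//.
      by rewrite lerXn2r// nnegrE ?mulr_ge0.
    - exact: le_trans vV (ler_norm V).
  by rewrite /E !mulrA [n%:R * _]mulrC.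
split.
- have := remainder 1%N; rewrite big_nat1 expr0 fact0 invr1 scale1r.
  rewrite mulmxBl mul1mx => /le_trans; apply; rewrite expr1.
  rewrite mulrAC ler_wpM2r// mulrDl lerDl.
  by rewrite mulr_ge0// ?exprn_ge0// mulr_ge0.
- have := remainder 2%N; rewrite big_nat_recl// big_nat1 /= expr0 expr1 fact0.
  rewrite invr1 !scale1r mulmxBl mulmxDl mul1mx -scalemxAl => /le_trans; apply.
  rewrite exprMn mulrAC ler_wpM2r ?exprn_ge0// mulrDl lerDr.
  by rewrite mulr_ge0.
Qed.

(** The quantity bounded is [(1 + q) * e k + r] rather than [e k]: it dominates [e k.+1], which
    drives the induction, and later also the error at every point of cell [k]. *)
Lemma discrete_gronwall (R : realType) (e : nat -> R) (q r : R) N :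
  0 <= q -> 0 <= r -> e 0%N <= 0 ->
  (forall k, (k < N)%N -> e k.+1 <= (1 + q) * e k + r) ->
  forall k, (k <= N)%N -> (1 + q) * e k + r <= k.+1%:R * r * (1 + q) ^+ k.+1.
Proof.
move=> q0 r0 e0 step.
have q1 : 1 <= 1 + q by rewrite lerDl.
have q01 := le_trans ler01 q1.
elim=> [_|k IH kN]; first by rewrite mul1r expr1; nra.
have /(le_trans (step _ kN)) ek := IH (ltnW kN).
(* Inflating the last [r] by [(1 + q) ^+ k.+2 >= 1] makes the sum equal to the bound at [k.+1]. *)
apply: (@le_trans _ _ ((1 + q) * (k.+1%:R * r * (1 + q) ^+ k.+1) +
    r * (1 + q) ^+ k.+2)).
  by rewrite lerD ?ler_wpM2l ?ler_peMr ?exprn_ege1.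
rewrite [_ ^+ k.+2]exprS -[k.+2%:R]natr1 le_eqVlt; apply/orP; left.
by apply/eqP; ring.
Qed.

Lemma exprD1_le_expR (R : realType) (x : R) k :
  0 <= x -> (1 + x) ^+ k <= expR (x * k%:R).
Proof.
move=> x0; rewrite expRM_natr lerXn2r ?nnegrE ?expR_ge0 ?expR_ge1Dx//.
by rewrite addr_ge0.
Qed.

(** * Increments of exact solutions *)

Lemma is_derive_coord (R : realType) m n (M : R -> 'M[R]_(m, n)) t v l i j :
  is_derive t v M l -> is_derive t v (fun x => M x i j) (l i j).
Proof.
move=> [dM <-]; split; first exact: ((derivable_mxP _ _ _).1 dM i j).
by rewrite derive_mx// mxE.
Qed.

Lemma within_continuous_coord (R : realType) m n (I : set R)
    (M : R -> 'M[R]_(m, n)) i j :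
  {within I, continuous M} -> {within I, continuous (fun x => M x i j)}.
Proof.
move=> cM x; apply: (cvg_comp _ (fun N : 'M[R]_(m, n) => N i j) (cM x)).
exact: coord_continuous.
Qed.

(** The velocity is bounded by [F], which gives the first bound. For the second, the velocity at an
    intermediate time [c] differs from that at [s] by at most [L * |w c - w s|], hence by at most
    [L * F * (t - s)]. *)
Lemma solution_increment (R : realType) n (D : set 'cV[R]_n)
    (A : 'cV[R]_n -> 'M[R]_n) y0 T w (F L : R) :
  (forall y, D y -> `|A y *m y| <= F) -> 0 <= F -> 0 <= L ->
  (forall y z, D y -> D z -> `|A y *m y - A z *m z| <= L * `|y - z|) ->
  is_linear_form_solution D A y0 T w ->
  forall s t, 0 <= s -> s <= t -> t <= T ->
    `|w t - w s| <= F * (t - s) /\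
    `|w t - (w s + (t - s) *: (A (w s) *m w s))| <= L * F * (t - s) ^+ 2.
Proof.
move=> AF F0 L0 AL [cw _ Dw dw].
(* The mean value theorem is applied entry by entry, so the point [c] depends on the entry. *)
have mvt s t i j : 0 <= s -> s <= t -> t <= T -> exists2 c : R, c \in `[s, t] &
    w t i j - w s i j = (A (w c) *m w c) i j * (t - s).
  move=> s0 st tT.
  have sub (x : R) : x \in `]s, t[ -> x \in `]0, T[.
    rewrite !in_itv /= => /andP[sx xt].
    by rewrite (le_lt_trans s0 sx) (lt_le_trans xt tT).
  have dcoord x : x \in `]s, t[ ->
      is_derive x 1 (fun x => w x i j) ((A (w x) *m w x) i j).
    by move=> /sub xT; apply: is_derive_coord; exact: dw.
  have ccoord : {within `[s, t], continuous (fun x => w x i j)}.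
    apply: (continuous_subspaceW (B := `[0, T])); last first.
      exact: within_continuous_coord.
    move=> x; rewrite /= !in_itv /= => /andP[sx xt].
    by rewrite (le_trans s0 sx) (le_trans xt tT).
  exact: MVT_segment st dcoord ccoord.
have inD s x : 0 <= s -> x \in `[s, T] -> D (w x).
  move=> s0; rewrite in_itv /= => /andP[sx xT].
  by apply: Dw; rewrite in_itv /= xT (le_trans s0 sx).
have inc s t : 0 <= s -> s <= t -> t <= T -> `|w t - w s| <= F * (t - s).
  move=> s0 st tT; apply: mx_norm_le => [|i j].
    by rewrite mulr_ge0// subr_ge0.
  have -> : (w t - w s) i j = w t i j - w s i j by rewrite !mxE.
  have [c cst ->] := mvt s t i j s0 st tT.
  rewrite normrM (@ger0_norm _ (t - s)) ?subr_ge0// ler_wpM2r ?subr_ge0//.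
  apply: le_trans (le_mx_norm _ _ _) (AF _ (inD s c s0 _)).
  by move: cst; rewrite !in_itv /= => /andP[-> ct]; exact: le_trans ct tT.
move=> s t s0 st tT; split; first exact: inc.
apply: mx_norm_le => [|i j]; first by rewrite !mulr_ge0// ?exprn_ge0 ?subr_ge0.
have [c cst e] := mvt s t i j s0 st tT; move: (cst); rewrite in_itv /=.
move=> /andP[sc ct]; have cT := le_trans ct tT; have ts0 : 0 <= t - s by lra.
have coordE (M N P Q : 'cV[R]_n) r : M i j - N i j = P i j * r ->
    (M - (N + r *: Q)) i j = (P - Q) i j * r.
  by move=> MNP; rewrite !mxE mulrBl -MNP; ring.
rewrite (coordE _ _ _ _ _ e).
rewrite normrM (ger0_norm ts0) expr2 mulrA ler_wpM2r//.
apply: le_trans (le_mx_norm _ _ _) _; apply: le_trans (AL _ _ _ _) _.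
- by apply: (inD s) => //; rewrite in_itv /= sc.
- by apply: (inD s) => //; rewrite in_itv /= lexx (le_trans st).
- rewrite -mulrA ler_wpM2l//; apply: le_trans (inc _ _ s0 sc cT) _.
  by rewrite ler_wpM2l// lerD2r.
Qed.

(** * Global error and uniform convergence of the scheme *)

Lemma grid_cell (R : realType) (h : R) N t :
  (0 < N)%N -> 0 <= t -> t <= h * N%:R ->
  exists2 k, (k < N)%N & t \in `[h * k%:R, h * k.+1%:R].
Proof.
case: N => // N _ t0; elim: N => [|N IH] tN.
  by exists 0%N => //; rewrite in_itv /= mulr0 t0.
have [/IH[k kN kt]|Nt] := leP t (h * N.+1%:R).
  by exists k => //; exact: ltnW.
by exists N.+1 => //; rewrite in_itv /= ltW.
Qed.

Lemma segmentary_error (R : realType) n (D : set 'cV[R]_n)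
    (A : 'cV[R]_n -> 'M[R]_n) y0 (T B V L : R) w :
  0 < T -> 0 <= L ->
  (forall y, D y -> `|A y| <= B) -> (forall y, D y -> `|y| <= V) ->
  (forall y z, D y -> D z -> `|A y *m y - A z *m z| <= L * `|y - z|) ->
  is_linear_form_solution D A y0 T w ->
  exists C : R, forall N u, (0 < N)%N -> segmentary_solution D A y0 T N u ->
    forall t, t \in `[0, T] -> `|w t - u t| <= C / N%:R.
Proof.
move=> T0 L0 AB DV AL wsol; have [_ w0 Dw _] := wsol.
have Dw0 : D (w 0) by apply: Dw; rewrite in_itv /= lexx ltW.
have B0 : 0 <= B by apply: le_trans (AB _ Dw0).
have V0 : 0 <= V by apply: le_trans (DV _ Dw0).
pose F := n%:R * B * V; have F0 : 0 <= F by rewrite /F !mulr_ge0.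
have AF y : D y -> `|A y *m y| <= F.
  move=> Dy; apply: le_trans (norm_mulmx _ _) _.
  by rewrite ler_pM ?mulr_ge0// ?ler_wpM2l ?AB ?DV.
have [C1 C10 expC] := expmx_increment n B V T.
(* One-step defect: [C1] from linearizing the exponential, [L * F] from linearizing [w], and the
   last summand from passing between [uk] and the midpoint value [ys]. *)
pose C := C1 + L * F + (n%:R * B + L) * C1.
have C0 : 0 <= C by rewrite /C !addr_ge0// !mulr_ge0// addr_ge0// mulr_ge0.
exists (C * T ^+ 2 * expR (T * L)) => N u N0 [u0 useg].
set h := T / N%:R in useg; have NR0 : (0 : R) < N%:R by rewrite ltr0n.
have h0 : 0 < h by rewrite divr_gt0.
have hN : h * N%:R = T by rewrite mulfVK// gt_eqF.
have tkT k : (k <= N)%N -> h * k%:R <= T.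
  by move=> kN; rewrite -hN ler_pM2l// ler_nat.
pose e k := `|u (h * k%:R) - w (h * k%:R)|.
(* Stated on the whole cell, so that it yields both the recursion at the nodes and the bound between
   them. *)
have local k t : (k < N)%N -> t \in `[h * k%:R, h * k.+1%:R] ->
    `|u t - w t| <= (1 + h * L) * e k + C * h ^+ 2.
  move=> kN tk; have /= [Du Dys /(_ t tk) ut] := useg k kN.
  move: tk; rewrite in_itv /= => /andP[kt]; rewrite -natr1 mulrDr mulr1 => tk.
  have tk0 : 0 <= h * k%:R by rewrite mulr_ge0// ltW.
  have hT : h <= T by rewrite -[leLHS]mulr1; apply: (tkT 1%N).
  have tT : t <= T.
    by apply: le_trans (tkT k.+1 kN); rewrite -natr1 mulrDr mulr1.
  set ys := expmx _ *m _ in Dys ut *; set uk := u (h * k%:R) in Du ys Dys ut *.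
  set wk := w (h * k%:R); set s := t - h * k%:R in ut *.
  have Dwk : D wk by apply: Dw; rewrite in_itv /= tk0 tkT// ltnW.
  have s0 : 0 <= s by rewrite /s subr_ge0.
  have sh : s <= h by rewrite /s; lra.
  have ysuk : `|uk - ys| <= C1 * h.
    have [||+ _] := expC (A uk) uk (h / 2) (AB _ Du) (DV _ Du); [lra|lra|].
    by rewrite distrC => /le_trans; apply; rewrite ler_wpM2l//; lra.
  have [_] := expC (A ys) uk s (AB _ Dys) (DV _ Du) s0 (le_trans sh hT).
  rewrite -ut => uP.
  have [_] := solution_increment AF F0 L0 AL wsol tk0 kt tT.
  rewrite -/s -/wk => wP.
  (* Two linearization remainders, the error at the node, two midpoint corrections through
     [A ys *m ys], and the propagated error in the velocity. *)
  have -> : u t - w t = (u t - (uk + s *: (A ys *m uk)))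
      - (w t - (wk + s *: (A wk *m wk))) + (uk - wk)
      + s *: (A ys *m (uk - ys)) + s *: (A ys *m ys - A uk *m uk)
      + s *: (A uk *m uk - A wk *m wk).
    rewrite mulmxBr !scalerBr.
    by apply/matrixP => i j; rewrite !mxE; ring.
  apply: (@le_trans _ _ (C1 * s ^+ 2 + L * F * s ^+ 2 + e k +
      s * (n%:R * B * (C1 * h)) + s * (L * (C1 * h)) + s * (L * e k))).
    have normZs (M : 'cV[R]_n) c : `|M| <= c -> `|s *: M| <= s * c.
      by move=> Mc; rewrite normrZ (ger0_norm s0) ler_wpM2l.
    apply: le_trans (ler_normD _ _) _; apply: lerD; last exact/normZs/AL.
    apply: le_trans (ler_normD _ _) _; apply: lerD; last first.
      by apply/normZs/(le_trans (AL _ _ Dys Du)); rewrite distrC ler_wpM2l.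
    apply: le_trans (ler_normD _ _) _; apply: lerD; last first.
      apply/normZs/(le_trans (norm_mulmx _ _)).
      by rewrite ler_pM ?mulr_ge0// ler_wpM2l// AB.
    apply: le_trans (ler_normD _ _) _; apply: lerD; last by [].
    by apply: le_trans (ler_normB _ _) _; exact: lerD.
  have e0 : 0 <= e k by rewrite /e.
  have s2 : s ^+ 2 <= h ^+ 2 by rewrite lerXn2r ?nnegrE ?(ltW h0).
  (* The target is the preceding bound with [s] replaced by [h], and [s <= h]. *)
  have -> : (1 + h * L) * e k + C * h ^+ 2 =
      C1 * h ^+ 2 + L * F * h ^+ 2 + e k +
      h * (n%:R * B * (C1 * h)) + h * (L * (C1 * h)) + h * (L * e k).
    by rewrite /C; ring.
  by rewrite !lerD// ?ler_wpM2l ?ler_wpM2r ?mulr_ge0// ltW.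
move=> t; rewrite in_itv /= => /andP[t0 tT].
have tN : t <= h * N%:R by rewrite hN.
have [k kN tk] := grid_cell N0 t0 tN.
rewrite distrC; apply: le_trans (local k t kN tk) _.
have hL0 : 0 <= h * L by rewrite mulr_ge0// ltW.
have Ch0 : 0 <= C * h ^+ 2 by rewrite mulr_ge0 ?exprn_ge0// ltW.
have e00 : e 0%N <= 0 by rewrite /e mulr0 u0 w0 subrr normr0.
have estep j : (j < N)%N -> e j.+1 <= (1 + h * L) * e j + C * h ^+ 2.
  move=> jN; apply: local jN _; rewrite in_itv /= lexx andbT.
  by rewrite ler_pM2l// ler_nat.
apply: le_trans (discrete_gronwall hL0 Ch0 e00 estep (ltnW kN)) _.
(* As [h * N%:R = T], the [N] defects of size [C * h ^+ 2] add up to [C * T ^+ 2 / N%:R]. *)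
have -> : C * T ^+ 2 * expR (T * L) / N%:R =
    N%:R * (C * h ^+ 2) * expR (h * L * N%:R).
  have -> : h * L * N%:R = T * L by rewrite mulrAC hN.
  rewrite -hN; field; exact: lt0r_neq0.
apply: ler_pM.
- by rewrite mulr_ge0.
- by rewrite exprn_ge0// addr_ge0.
- by rewrite ler_wpM2r// ler_nat.
- apply: le_trans (exprD1_le_expR _ hL0) _.
  by rewrite ler_expR ler_wpM2l// ler_nat.
Qed.

Lemma segmentary_cvg (R : realType) n (D : set 'cV[R]_n)
    (A : 'cV[R]_n -> 'M[R]_n) y0 (T B V L : R) (yN : nat -> R -> 'cV[R]_n) w :
  0 < T -> 0 <= L ->
  (forall y, D y -> `|A y| <= B) -> (forall y, D y -> `|y| <= V) ->
  (forall y z, D y -> D z -> `|A y *m y - A z *m z| <= L * `|y - z|) ->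
  (\forall N \near \oo, segmentary_solution D A y0 T N (yN N)) ->
  is_linear_form_solution D A y0 T w ->
  {uniform `[0, T], yN @ \oo --> w}.
Proof.
move=> T0 L0 AB DV AL yNseg wsol.
have [C errC] := segmentary_error T0 L0 AB DV AL wsol.
move=> P /uniform_nbhs[E [/= entE EP]].
have [eps /= eps0 epsE] : exists2 eps : R, 0 < eps &
    forall a b : 'cV[R]_n, `|a - b| < eps -> E (a, b).
  move: entE; rewrite -entourage_ballE => -[eps /= eps0 epsE].
  by exists eps => // a b ab; apply: epsE; rewrite /= -ball_normE.
near=> N; apply: EP => t tT /=; apply: epsE.
apply: le_lt_trans (errC N (yN N) _ _ t tT) _.
- by near: N; exists 1%N.
- by near: N.
- have N0 : (0 < N)%N by near: N; exists 1%N.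
  rewrite ltr_pdivrMr ?ltr0n// mulrC -ltr_pdivrMr//.
  by near: N; exact: nbhs_infty_gtr.
Unshelve. all: by end_near. Qed.

(** * Compactness and equivalence of norms *)

Lemma norm_trmx (R : realType) m n (M : 'M[R]_(m, n)) : `|M^T| = `|M|.
Proof.
suff le p q (N : 'M[R]_(p, q)) : `|N^T| <= `|N|.
  by apply/eqP; rewrite eq_le le/= -{1}[M]trmxK le.
by apply: mx_norm_le => // i j; rewrite mxE le_mx_norm.
Qed.

Lemma trmx_continuous (R : realType) m n :
  continuous (trmx : 'M[R]_(m, n) -> 'M[R]_(n, m)).
Proof.
move=> /= M P /= /nbhs_ballP[e /= e0 eP]; apply/nbhs_ballP.
exists e => //= N [_ MN].
by apply: eP; split=> // i j; rewrite !mxE; exact: MN.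
Qed.

(** Heine-Borel for row vectors, carried to columns by transposition, which is continuous and
    preserves the sup norm. *)
Lemma cV_bounded_closed_compact (R : realType) n (S : set 'cV[R]_n) c :
  (forall x, S x -> `|x| <= c) -> closed S -> compact S.
Proof.
move=> Sc clS; have -> : S = trmx @` (trmx @^-1` S).
  apply/seteqP; split=> [x Sx|_ [x Sx <-]//].
  by exists x^T; rewrite /= trmxK.
apply: continuous_compact; first exact/continuous_subspaceT/trmx_continuous.
apply: bounded_closed_compact.
  exists c; split; first exact: num_real.
  move=> b /ltW cb x /Sc; rewrite norm_trmx => /le_trans; exact.
by apply: closed_comp clS => x _; exact: trmx_continuous.
Qed.

(** Expansion in the standard basis; the constant is the sum of the norms of the basis vectors. *)
Lemma is_norm_le_mx_norm (R : realType) n (nrm : 'cV[R]_n -> R) :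
  is_norm nrm -> exists2 C, 0 <= C & forall x, nrm x <= C * `|x|.
Proof.
move=> [nrm0 _ nrmZ nrmD].
exists (\sum_(i < n) nrm (delta_mx i 0)); first by rewrite sumr_ge0.
move=> x; rewrite {1}[x]matrix_sum_delta mulr_suml.
elim/big_ind2 : _ => [||i _].
- by rewrite -(scale0r 0) nrmZ normr0 mul0r.
- by move=> y a z b ya zb; apply: le_trans (nrmD _ _) _; exact: lerD.
- by rewrite big_ord1 nrmZ mulrC ler_wpM2l// le_mx_norm.
Qed.

Lemma is_norm_continuous (R : realType) n (nrm : 'cV[R]_n -> R) y0 :
  is_norm nrm -> continuous (fun y => nrm (y - y0)).
Proof.
move=> hnrm; have [C C0 nrmC] := is_norm_le_mx_norm hnrm.
have [_ _ nrmZ nrmD] := hnrm.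
have nrmB x y : nrm x - nrm y <= C * `|x - y|.
  by apply: le_trans (nrmC _); rewrite lerBlDr -{1}[x](subrK y).
move=> /= x P /= /nbhs_ballP[e /= e0 eP]; apply/nbhs_ballP.
(* The denominator is [C + 1] because [C] may vanish. *)
exists (e / (C + 1)); first by rewrite /= divr_gt0// ltr_wpDl.
move=> y; rewrite -ball_normE /= ltr_pdivlMr ?ltr_wpDl// => xy.
apply: eP; rewrite -ball_normE /=; apply: le_lt_trans xy.
apply: (@le_trans _ _ (C * `|x - y|)).
  have -> : x - y = (x - y0) - (y - y0) by rewrite opprB addrA subrK.
  by rewrite ler_norml lerNl opprB nrmB distrC nrmB.
by rewrite mulrC ler_wpM2l// lerDl.
Qed.

(** The image under [nrm] of the compact sup-norm unit sphere is closed and omits 0, hence misses a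
    ball of some radius [e] around 0; homogeneity then gives the constant [e^-1]. *)
Lemma mx_norm_le_is_norm (R : realType) n (nrm : 'cV[R]_n -> R) :
  is_norm nrm -> exists2 c, 0 < c & forall x, `|x| <= c * nrm x.
Proof.
move=> hnrm; have [nrm0 nrm_eq0 nrmZ _] := hnrm.
pose S := [set x : 'cV[R]_n | `|x| = 1].
have cptS : compact S.
  apply: (@cV_bounded_closed_compact _ _ _ 1) => [x /= ->//|].
  apply: (closed_comp (f := fun x : 'cV[R]_n => `|x|) (D := [set 1])) => [x _|].
    exact: norm_continuous.
  exact: closed_eq.
have clI : closed (nrm @` S).
  apply: compact_closed; first exact: Rhausdorff.
  apply: continuous_compact cptS.
  apply: continuous_subspaceT.
  have -> : nrm = (fun x => nrm (x - 0)) by apply/funext => x; rewrite subr0.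
  exact: is_norm_continuous.
have : nbhs (0 : R) (~` (nrm @` S)).
  apply: open_nbhs_nbhs; split; first exact: closed_openC.
  move=> [x xS /nrm_eq0 x0]; move: xS; rewrite /S/= x0 normr0 => /eqP.
  by rewrite eq_sym oner_eq0.
move=> /nbhs_ballP[e /= e0 eS].
exists e^-1; first by rewrite invr_gt0.
move=> x; have [->|x0] := eqVneq x 0.
  by rewrite normr0 mulr_ge0// invr_ge0 ltW.
have nx0 : 0 < `|x| by rewrite normr_gt0.
rewrite -ler_pdivrMl ?invr_gt0// invrK leNgt; apply/negP => xe.
apply: (eS (nrm (`|x|^-1 *: x))).
  rewrite -ball_normE /= sub0r normrN ger0_norm// nrmZ normfV normr_id.
  by rewrite mulrC ltr_pdivrMr.
exists (`|x|^-1 *: x) => //.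
by rewrite /S /= normrZ normfV normr_id mulVf// gt_eqF.
Qed.

Lemma norm_ball_compact (R : realType) n (nrm : 'cV[R]_n -> R) y0 d :
  is_norm nrm -> compact (norm_ball nrm y0 d).
Proof.
move=> hnrm; have [c c0 nrmc] := mx_norm_le_is_norm hnrm.
apply: (@cV_bounded_closed_compact _ _ _ (c * d + `|y0|)) => [y yd|].
  rewrite -[y](subrK y0) (le_trans (ler_normD _ _))// lerD2r.
  by rewrite (le_trans (nrmc _))// ler_wpM2l// ltW.
apply: (closed_comp (f := fun y => nrm (y - y0)) (D := [set r : R | r <= d])).
  by move=> y _; exact: is_norm_continuous.
exact: closed_le.
Qed.

Lemma mx_bounded_on_compact (R : realType) (T : topologicalType) m n (D : set T)
    (A : T -> 'M[R]_(m, n)) :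
  compact D -> (forall i j, {within D, continuous (fun y => A y i j)}) ->
  exists B, forall y, D y -> `|A y| <= B.
Proof.
move=> cD cA.
have bA (ij : 'I_m * 'I_n) : exists B, forall y, D y -> `|A y ij.1 ij.2| <= B.
  have [M [_ MA]] := compact_bounded (continuous_compact (cA ij.1 ij.2) cD).
  (* Every number strictly above [M] is a bound, hence [M + 1]. *)
  by exists (M + 1) => y Dy; apply: MA; [rewrite ltrDl|exists y].
have [B AB] := choice bA.
exists (\sum_ij `|B ij|) => y Dy; apply: mx_norm_le => [|i j].
  by rewrite sumr_ge0.
rewrite (bigD1 (i, j))//= (le_trans (AB (i, j) y Dy))//.
by rewrite (le_trans (ler_norm _))// lerDl sumr_ge0.
Qed.

(** * Derivatives, uniqueness and the theorem *)

Lemma is_derivative_within_interior (R : realType) n (I : set R)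
    (y : R -> 'cV[R]_n) t l :
  nbhs t I -> is_derivative_within I y t l -> is_derive t 1 y l.
Proof.
move=> It dy.
have cvg_quot : (fun h => h^-1 *: (y (h *: 1 + t) - y t)) @ 0^' --> l.
  move=> P /dy dP.
  have {}dP : t^' [set s | I s -> P ((s - t)^-1 *: (y s - y t))] by exact: dP.
  have : t^' [set s | P ((s - t)^-1 *: (y s - y t))].
    by apply: filterS2 dP (nbhs_dnbhs It) => s; apply.
  (* The substitution [s = h + t] turns one difference quotient into the other. *)
  move=> /nbhs_ballP[e /= e0 eP]; apply/nbhs_ballP; exists e => //= h he h0.
  have -> : h^-1 = ((h *: 1 + t) - t)^-1 by rewrite addrK [h *: _]mulr1.
  apply: eP.
    by move: he; rewrite /ball /= [h *: _]mulr1 opprD addrCA subrr addr0 sub0r.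
  by rewrite -subr_eq0 addrK [h *: _]mulr1.
by split; [apply/cvg_ex; exists l|exact: cvg_lim cvg_quot].
Qed.

(** Restricting uniform convergence to a singleton gives pointwise convergence, whose limit is
    unique in a Hausdorff space. *)
Lemma uniform_limit_unique (R : realType) n (I : set R)
    (u : nat -> R -> 'cV[R]_n) (z w : R -> 'cV[R]_n) :
  {uniform I, u @ \oo --> z} -> {uniform I, u @ \oo --> w} ->
  forall t, I t -> w t = z t.
Proof.
move=> uz uw t It; have tI : [set t] `<=` I by move=> _ ->.
have := uniform_subset_cvg _ tI uz; rewrite uniform_set1 => utz.
have := uniform_subset_cvg _ tI uw; rewrite uniform_set1 => utw.
exact: (cvg_unique (@norm_hausdorff _ _) (utw _) (utz _)).
Qed.

(** Because [T < a], all of [[0, T]] is interior to [[-a, a]]: the relative derivatives are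
    two-sided there, even at 0 and [T], which also gives continuity. *)
Lemma C1_solution_linear_form (R : realType) n (D : set 'cV[R]_n)
    (f : 'cV[R]_n -> 'cV[R]_n) (A : 'cV[R]_n -> 'M[R]_n) y0 a T y :
  (forall v, D v -> f v = A v *m v) -> 0 < T -> T < a ->
  is_C1_solution D f y0 a y -> is_linear_form_solution D A (y 0) T y.
Proof.
move=> fA T0 Ta [_ Dy [dy _ ydy]].
have sub (t : R) : t \in `[0, T] -> t \in `](- a), a[.
  by rewrite !in_itv /= => /andP[t0 tT]; apply/andP; split; lra.
have Dy' (t : R) : t \in `[0, T] -> D (y t).
  by move=> /sub/subset_itv_oo_cc; exact: Dy.
have der (t : R) : t \in `[0, T] -> is_derive t 1 y (A (y t) *m y t).
  move=> tT; have [dyt eq_dy] := ydy t (subset_itv_oo_cc (sub t tT)).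
  rewrite -fA; last exact: Dy'.
  rewrite -eq_dy; apply: is_derivative_within_interior dyt.
  have : nbhs t `](- a), a[%classic by apply: near_in_itvoo; exact: sub.
  by apply: filterS => x; exact: subset_itv_oo_cc.
split=> //.
- apply: continuous_in_subspaceT => t; rewrite inE => tT.
  have [dyt _] := der t tT.
  exact/differentiable_continuous/derivable1_diffP.
- by move=> t /subset_itv_oo_cc; exact: der.
Qed.

Theorem mainTheorem1 (R : realType) (n : nat) (hn : (0 < n)%N)
    (nrm : 'cV[R]_n -> R) (hnrm : is_norm nrm)
    (a d K : R) (ha : 0 < a) (hd : 0 < d) (hK : 0 < K)
    (y0 : 'cV[R]_n) (D : set 'cV[R]_n) (hD : D = norm_ball nrm y0 d)
    (f : 'cV[R]_n -> 'cV[R]_n) (A : 'cV[R]_n -> 'M[R]_n)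
    (hfcont : {within D, continuous f})
    (hfLip : lipschitz_wrt nrm K D f)
    (hfA : forall y, D y -> f y = A y *m y)
    (hAcont : forall i j, {within D, continuous (fun y => A y i j)})
    (y : R -> 'cV[R]_n) (hy : is_C1_solution D f y0 a y)
    (T : R) (hT0 : 0 < T) (hTa : T < a)
    (yN : nat -> R -> 'cV[R]_n)
    (hyN : \forall N \near \oo, segmentary_solution D A y0 T N (yN N)) :
  exists z : R -> 'cV[R]_n,
    [/\ {uniform `[0, T], yN @ \oo --> z},
        {within `[0, T], continuous z},
        forall t, t \in `]0, T[ -> derivable z t 1,
        is_linear_form_solution D A (y 0) T z &
        forall w : R -> 'cV[R]_n,
          is_linear_form_solution D A (y 0) T w ->
          forall t, t \in `[0, T] -> w t = z t].
Proof.
have [C C0 nrmC] := is_norm_le_mx_norm hnrm.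
have [c c0 nrmc] := mx_norm_le_is_norm hnrm.
have cptD : compact D by rewrite hD; exact: norm_ball_compact.
have [B AB] := mx_bounded_on_compact cptD hAcont.
have [V DV] : exists V, forall v, D v -> `|v| <= V.
  apply: mx_bounded_on_compact cptD _ => i j.
  exact/continuous_subspaceT/coord_continuous.
(* The Lipschitz constant for the sup norm: [K] for [nrm], times the two equivalence constants. *)
have L0 : 0 <= c * K * C by rewrite !mulr_ge0// ltW.
have AL v w : D v -> D w -> `|A v *m v - A w *m w| <= c * K * C * `|v - w|.
  move=> Dv Dw; rewrite -!hfA//; apply: le_trans (nrmc _) _.
  rewrite -!mulrA ler_pM2l//; apply: le_trans (hfLip _ _ Dv Dw) _.
  by rewrite ler_pM2l.
have ysol := C1_solution_linear_form hfA hT0 hTa hy.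
have [yE _ _] := hy.
(* Convergence holds to every solution [w]; the case [w = y] gives existence of the limit, and
   comparing two cases gives uniqueness. *)
have cvg w : is_linear_form_solution D A (y 0) T w ->
    {uniform `[0, T], yN @ \oo --> w}.
  by rewrite yE; exact: segmentary_cvg hT0 L0 AB DV AL hyN.
have [ycont _ _ yder] := ysol.
exists y; split=> //; first exact: cvg.
  by move=> t /yder[].
by move=> w wsol; exact: uniform_limit_unique (cvg y ysol) (cvg w wsol).
Qed.
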